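(* Let $n\ge 1$ and let $X$ be a finite pure $n$-dimensional simplicial complex with connected links, equipped with the homogeneous weight function $m$. Assume that $X$ is $(n+1)$-partite with sides $S_0,\dots,S_n$ and partite-regular in the following sense: for every $0\le i\le n$ there is a constant $K_i$ such that every vertex $\{v\}$ with $v\in S_i$ is contained in exactly $K_i$ $n$-dimensional simplices of $X$, i.e. $m(\{v\})=n!\,K_i$. Assume there is a constant $0<\lambda<1$ such that for every $0\le k\le n-1$ and every $\tau\in X(k-1)$, $\mathrm{Spec}((M')^+_{\tau,0})\subseteq[-1,\lambda]\cup\{1\}$. Then $$\mathrm{overlap}(X)\ge\mathcal{P}_n\left(\mathcal{P}_n^n-C_n\lambda\right),$$ where $\mathcal{P}_n$ is the constant of Pach's theorem and $$C_n=\sum_{k=0}^{n-1}n!\,\frac{(n+1-k)^{n-k}}{(n-k-1)!}\left((k+1)(k+2)^{n-k}-(k+1)^{n-k+1}\right).$$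
   Context: $X(k)$ denotes the set of simplices of $X$ with $k+1$ vertices, $X(-1)=\{\emptyset\}$; a vertex $v$ is identified with $\{v\}\in X(0)$. $X$ is pure $n$-dimensional if every simplex is contained in a simplex of $X(n)$. For $\tau\in X(k)$ the link $X_\tau$ is the complex with $\eta\in X_\tau(l)$ iff $\eta\in X(l)$ and $\tau\cup\eta\in X(k+l+1)$; $X_\emptyset=X$. ''Connected links'' means that for every $-1\le k\le n-2$ and every $\tau\in X(k)$ the one-skeleton of $X_\tau$ (the graph with vertices $X_\tau(0)$ and edges $X_\tau(1)$) is connected; in particular the one-skeleton of $X$ is connected. $X$ is $(n+1)$-partite with sides $S_0,\dots,S_n\subseteq X(0)$ if the $S_i$ are disjoint, $X(0)=\bigcup_i S_i$, and $|\sigma\cap S_i|=1$ for every $\sigma\in X(n)$ and every $0\le i\le n$. Homogeneous weight: for $-1\le k\le n$ and $\tau\in X(k)$, $m(\tau)=(n-k)!\,|\{\sigma\in X(n):\tau\subseteq\sigma\}|$. On the link, $m_\tau(\eta)=m(\tau\cup\eta)$. The weighted random walk operator $(M')^+_{\tau,0}$ acts on functions $\phi:X_\tau(0)\to\mathbb{R}$ by $$(M')^+_{\tau,0}\phi(v)=\sum_{u:\{u,v\}\in X_\tau(1)}\frac{m_\tau(\{u,v\})}{m_\tau(\{v\})}\phi(u).$$ Overlap: $$\mathrm{overlap}(X)=\min_{f:X(0)\to\mathbb{R}^n}\max_{x\in\mathbb{R}^n}\frac{|\{\{v_0,\dots,v_n\}\in X(n):x\in\mathrm{conv}\{f(v_0),\dots,f(v_n)\}\}|}{|X(n)|},$$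 the minimum being over all maps $f$, and $\mathrm{conv}$ denoting convex hull. Pach's theorem (known): for every $n$ there is a constant $\mathcal{P}_n>0$ such that for any finite sets $S_0,\dots,S_n$ of points in $\mathbb{R}^n$ there are subsets $U_0\subseteq S_0,\dots,U_n\subseteq S_n$ with $|U_i|\ge\mathcal{P}_n|S_i|$ for every $0\le i\le n$ and $\bigcap_{x_0\in U_0,\dots,x_n\in U_n}\mathrm{conv}\{x_0,\dots,x_n\}\ne\emptyset$. $\mathcal{P}_n$ denotes such a constant. *)

(* Defs.v *)
From HB Require Import structures.
From mathcomp Require Import all_boot all_order all_algebra.
From mathcomp Require Import finmap.
From mathcomp Require Import all_classical all_reals all_analysis.

Set Implicit Arguments.
Unset Strict Implicit.
Unset Printing Implicit Defensive.
Import Order.TTheory GRing.Theory Num.Theory.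
Local Open Scope ring_scope.

Section Complexes.
Variable V : finType.
Implicit Types (X : {set {set V}}) (tau : {set V}).

Definition simplicial_complex X : Prop :=
  (finset.set0 \in X) /\
  (forall s t : {set V}, s \in X -> t \subset s -> t \in X).

(* Faces are indexed by their number of vertices: faces X j is the set X(j-1)
   of simplices of dimension j-1, so that faces X 0 is X(-1). *)
Definition faces X (j : nat) : {set {set V}} := [set s in X | #|s| == j].

Definition vertices X : {set V} := [set v | [set v] \in faces X 1].

Definition pure (n : nat) X : Prop :=
  forall s, s \in X -> exists2 t, t \in faces X n.+1 & s \subset t.

(* tau :|: eta has dimension dim tau + dim eta + 1, i.e. the two simplices are
   disjoint. *)
Definition link X tau : {set {set V}} :=
  [set eta in X | tau :|: eta \in faces X (#|tau| + #|eta|)].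

Definition skeleton_connected X : Prop :=
  forall u v, u \in vertices X -> v \in vertices X ->
    connect [rel x y | [set x; y] \in faces X 2] u v.

(* j = k + 1 for the dimension k of tau, -1 <= k <= n - 2 *)
Definition connected_links (n : nat) X : Prop :=
  forall (j : nat) tau, (j < n)%N -> tau \in faces X j ->
    skeleton_connected (link X tau).

Definition partite (n : nat) X (S : 'I_n.+1 -> {set V}) : Prop :=
  [/\ forall i j, i != j -> [disjoint S i & S j],
      vertices X = \bigcup_i S i
    & forall s i, s \in faces X n.+1 -> #|s :&: S i| = 1%N].

Definition top_degree (n : nat) X tau : nat :=
  #|[set s in faces X n.+1 | tau \subset s]|.

Definition partite_regular (n : nat) X (S : 'I_n.+1 -> {set V}) : Prop :=
  forall i, exists K : nat, forall v, v \in S i -> top_degree n X [set v] = K.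

(* The homogeneous weight m: for tau of dimension k = #|tau| - 1, the factor is
   (n - k)!. *)
Definition weight (n : nat) X tau : nat :=
  ((n.+1 - #|tau|)`! * top_degree n X tau)%N.

Definition link_weight (n : nat) X tau (eta : {set V}) : nat :=
  weight n X (tau :|: eta).

Definition link_vertex X tau : finType := {v : V | v \in vertices (link X tau)}.

Section Walk.
Variables (R : realType) (n : nat) (X : {set {set V}}) (tau : {set V}).

Definition walk (phi : {ffun link_vertex X tau -> R^o}) :
    {ffun link_vertex X tau -> R^o} :=
  [ffun v => \sum_(u | [set val u; val v] \in faces (link X tau) 2)
     (link_weight n X tau [set val u; val v])%:R
       / (link_weight n X tau [set val v])%:R * phi u].

Fact walk_is_linear : linear walk.
Proof.
move=> a f g; apply/ffunP => v; rewrite !ffunE scaler_sumr -big_split /=.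
apply: eq_bigr => u _; rewrite !ffunE mulrDr; congr (_ + _).
by rewrite /GRing.scale /= mulrCA.
Qed.

HB.instance Definition _ :=
  GRing.isLinear.Build R {ffun link_vertex X tau -> R^o}
    {ffun link_vertex X tau -> R^o} *:%R walk walk_is_linear.

(* The walk is self-adjoint for the inner product weighted by link_weight, so
   its spectrum consists of real eigenvalues. *)
Definition walk_spectrum : set R :=
  [set a | passmx.leigenvalue (linfun walk) a].

Lemma walk_spectrumP (a : R) :
  walk_spectrum a <-> exists2 phi, phi != 0 & walk phi = a *: phi.
Proof.
rewrite /walk_spectrum /= /passmx.leigenvalue /passmx.leigenspace.
split=> [|[phi nz eq_phi]].
  rewrite -vpick0; set phi := vpick _ => nz; exists phi => //.
  have := memv_pick (lker (linfun walk - a *: \1%VF)).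
  by rewrite -/phi memv_ker !lfun_simp subr_eq0 /= => /eqP.
apply: contraNneq nz => ker0.
rewrite -memv0 -ker0 memv_ker !lfun_simp subr_eq0 /=.
by rewrite eq_phi.
Qed.

End Walk.
End Complexes.

Arguments walk_spectrum {V} R n X tau.
Arguments partite {V} n X S.
Arguments partite_regular {V} n X S.

Definition convex_hull (R : realType) (E : lmodType R) (A : set E) : set E :=
  smallest (@convex_set R E) A.

Section Overlap.
Variables (R : realType) (V : finType) (n : nat) (X : {set {set V}}).

(* Only the values of f on the vertices of X matter. *)
Definition covering (f : V -> 'rV[R]_n) (x : 'rV[R]_n) : {set {set V}} :=
  [set s in faces X n.+1 | `[< convex_hull (f @` [set` s])%classic x >]].

Definition covering_ratio (f : V -> 'rV[R]_n) (x : 'rV[R]_n) : R :=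
  #|covering f x|%:R / #|faces X n.+1|%:R.

Definition max_covering (f : V -> 'rV[R]_n) : R :=
  sup (range (covering_ratio f)).

Definition overlap : R := inf (range max_covering).

(* The supremum and the infimum are a maximum and a minimum. *)
Lemma max_covering_attained f :
  exists2 x, max_covering f = covering_ratio f x
    & forall y, covering_ratio f y <= covering_ratio f x.
Proof.
pose P k := `[< exists x, #|covering f x| = k >].
have exP : exists k, P k by exists #|covering f 0|; apply/asboolP; exists 0.
have ubP k : P k -> (k <= #|{set V}|)%N.
  by move=> /asboolP[x <-]; exact: max_card.
case: (ex_maxnP exP ubP) => k /asboolP[x xk] kmax.
have xmax y : covering_ratio f y <= covering_ratio f x.
  rewrite ler_wpM2r ?invr_ge0 ?ler0n// ler_nat xk.
  by apply: kmax; apply/asboolP; exists y.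
exists x => //; apply/eqP; rewrite eq_le; apply/andP; split.
  apply: ge_sup; first by exists (covering_ratio f 0), 0.
  by move=> _ [y _ <-].
apply: ub_le_sup; last by exists x.
by exists (covering_ratio f x) => _ [y _ <-].
Qed.

Lemma overlap_attained :
  exists2 f, overlap = max_covering f
    & forall g, max_covering f <= max_covering g.
Proof.
pose P k := `[< exists f x,
  max_covering f = covering_ratio f x /\ #|covering f x| = k >].
have exP : exists k, P k.
  have [x fx _] := max_covering_attained (fun=> 0).
  by exists #|covering (fun=> 0) x|; apply/asboolP; exists (fun=> 0), x.
case: (ex_minnP exP) => k /asboolP[f [x [fx xk]]] kmin.
have fmin g : max_covering f <= max_covering g.
  have [y gy _] := max_covering_attained g.
  rewrite fx gy ler_wpM2r ?invr_ge0 ?ler0n// ler_nat xk.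
  by apply: kmin; apply/asboolP; exists g, y.
exists f => //; apply/eqP; rewrite eq_le; apply/andP; split.
  apply: ge_inf; last by exists f.
  by exists (max_covering f) => _ [g _ <-].
apply: lb_le_inf; first by exists (max_covering f), f.
by move=> _ [g _ <-].
Qed.

End Overlap.

Arguments overlap R {V} n X.

Definition pach_constant (R : realType) (n : nat) (P : R) : Prop :=
  0 < P /\
  forall S : 'I_n.+1 -> {fset 'rV[R]_n},
    exists U : 'I_n.+1 -> {fset 'rV[R]_n},
      [/\ forall i, (U i `<=` S i)%fset,
          forall i, P * #|` S i|%:R <= #|` U i|%:R
        & exists z, forall x : 'I_n.+1 -> 'rV[R]_n,
            (forall i, x i \in U i) -> convex_hull (range x) z].

Definition mixing_constant (R : realType) (n : nat) : R :=
  \sum_(k < n) n`!%:R * ((n.+1 - k)%:R ^+ (n - k) / (n - k).-1`!%:R)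
    * (k.+1%:R * k.+2%:R ^+ (n - k) - k.+1%:R ^+ (n - k).+1).

Arguments mixing_constant R n : clear implicits.

(* Main.v *)
Require Import Defs.
From mathcomp Require Import all_boot all_order all_algebra.
From mathcomp Require Import finmap.
From mathcomp Require Import all_classical all_reals all_analysis.
From mathcomp Require Import ring lra.
Set Implicit Arguments.
Unset Strict Implicit.
Unset Printing Implicit Defensive.
Import Order.TTheory GRing.Theory Num.Theory numFieldNormedType.Exports.
Local Open Scope ring_scope.

(* Pach's theorem gives subsets U_i of the sides, of density at least P, such
   that every top simplex with its i-th vertex in U_i for all i covers a common
   point. By partite regularity, the vertex x_i of color i of a random top
   simplex is uniform on S_i; scaling the indicator of U_i gives
   0 <= f_i <= 1 with E[f_i(x_i)] = P, and it remains to bound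
   E[f_0(x_0) ... f_n(x_n)] from below.

   Multiplying in the factors one at a time, the k-th step costs the covariance
   of f_0(x_0) ... f_(k-1)(x_(k-1)) and g = f_k - P, at most
   sqrt P * |E[g(x_k) | x_0, ..., x_(k-1)]| by Cauchy-Schwarz. The square of this
   norm is a sum of martingale increments over j < k. Conditionally on the face
   tau = {x_0, ..., x_(j-1)}, the increment is governed by the walk on the
   link of tau between the sides j and k: a function supported on these two
   sides and centered on each of them is orthogonal to the constants, so the
   one-sided spectral gap bounds the increment by
   ((n - j) lam)^2 E[Var(g(x_k) | tau)]. Hence each covariance is at most
   n^2 lam P, and the total error n^3 lam P is smaller than C_n lam P. *)

(** The first-order condition at an extremum. It yields the eigenvalue equation for a maximiser of
    the Rayleigh quotient. *)
Lemma quadratic_ge0_linear_eq0 (R : realFieldType) (b q : R) :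
  (forall t, 0 <= 2 * t * b + t ^+ 2 * q) -> b = 0.
Proof.
move=> qge0; apply/eqP/negPn/negP => b_neq0.
have b2_gt0 : 0 < b ^+ 2 by rewrite exprn_even_gt0.
have q_ge0 : 0 <= q by have := qge0 1; have := qge0 (-1); nra.
have q1_gt0 : 0 < q + 1 by lra.
(* The minimiser would be [- b / q]; adding 1 keeps the denominator positive when [q = 0]. *)
have := qge0 (- b / (q + 1)).
have -> : 2 * (- b / (q + 1)) * b + (- b / (q + 1)) ^+ 2 * q
   = - (b ^+ 2 * ((q + 2) / (q + 1) ^+ 2)) by field; lra.
rewrite oppr_ge0 leNgt; apply/negP/negPn.
by rewrite mulr_gt0// divr_gt0// ?exprn_gt0//; lra.
Qed.

(** * Rayleigh quotients on a connected weighted graph *)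

Section WeightedGraph.
Variables (R : realType) (I : finType) (W : I -> I -> R).
Hypothesis W_sym : forall u v, W u v = W v u.
Hypothesis W_ge0 : forall u v, 0 <= W u v.

Let D v := \sum_u W u v.
Hypothesis D_gt0 : forall v, 0 < D v.

(** The Rayleigh quotient of the walk is [form f f / mass f f], and [mean f = 0] says that [f] is
    [mass]-orthogonal to the constants. *)
Let form (f g : I -> R) := \sum_v \sum_u W u v * f u * g v.
Let mass (f g : I -> R) := \sum_v D v * f v * g v.
Let mean (f : I -> R) := \sum_v D v * f v.

Let formD f g t : form (fun v => f v + t * g v) (fun v => f v + t * g v) =
  form f f + 2 * t * form f g + t ^+ 2 * form g g.
Proof.
have form_sym : form g f = form f g.
  rewrite /form exchange_big; apply: eq_bigr => v _; apply: eq_bigr => u _ /=.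
  by rewrite W_sym mulrAC.
rewrite (_ : _ + _ = form f f + t * form f g + t * form g f + t ^+ 2 * form g g).
  rewrite /form !mulr_sumr -!big_split; apply: eq_bigr => v _ /=.
  rewrite !mulr_sumr -!big_split; apply: eq_bigr => u _ /=; ring.
by rewrite form_sym; ring.
Qed.

Let massD f g t : mass (fun v => f v + t * g v) (fun v => f v + t * g v) =
  mass f f + 2 * t * mass f g + t ^+ 2 * mass g g.
Proof.
rewrite /mass !mulr_sumr -!big_split; apply: eq_bigr => v _ /=; ring.
Qed.

Let formZ f t : form (fun v => t * f v) (fun v => t * f v) = t ^+ 2 * form f f.
Proof.
rewrite /form !mulr_sumr; apply: eq_bigr => v _.
by rewrite !mulr_sumr; apply: eq_bigr => u _; ring.
Qed.

Let massZ f t : mass (fun v => t * f v) (fun v => t * f v) = t ^+ 2 * mass f f.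
Proof. by rewrite /mass !mulr_sumr; apply: eq_bigr => v _; ring. Qed.

Let meanZ f t : mean (fun v => t * f v) = t * mean f.
Proof. by rewrite /mean !mulr_sumr; apply: eq_bigr => v _; ring. Qed.

Let sqr_term_ge0 (f : I -> R) v : 0 <= D v * f v * f v.
Proof. by rewrite -mulrA -expr2; exact: (mulr_ge0 (ltW (D_gt0 v)) (sqr_ge0 _)). Qed.

Let mass_ge0 f : 0 <= mass f f.
Proof. by apply: sumr_ge0 => v _; exact: sqr_term_ge0. Qed.

Let le_mass f v : D v * f v ^+ 2 <= mass f f.
Proof.
rewrite /mass (bigD1 v)//= expr2 mulrA lerDl.
by apply: sumr_ge0 => u _; exact: sqr_term_ge0.
Qed.

Let mass_eq0 f : mass f f = 0 -> forall v, f v = 0.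
Proof.
move=> f0 v; apply/eqP; rewrite -sqrf_eq0.
have := le_mass f v; rewrite f0 (pmulr_rle0 _ (D_gt0 v)) => f_le0.
by rewrite eq_le f_le0 sqr_ge0.
Qed.

(** The left side is the Dirichlet energy, a sum of nonnegative terms over the edges. *)
Let mass_form f :
  \sum_v \sum_u W u v * (f u - f v) ^+ 2 = 2 * mass f f - 2 * form f f.
Proof.
pose s := \sum_v \sum_u W u v * f v ^+ 2.
have sE : mass f f = s.
  rewrite /mass /s; apply: eq_bigr => v _; rewrite -mulrA mulr_suml.
  by apply: eq_bigr => u _; rewrite expr2.
have s'E : s = \sum_v \sum_u W u v * f u ^+ 2.
  rewrite /s exchange_big; apply: eq_bigr => v _; apply: eq_bigr => u _ /=.
  by rewrite W_sym.
have -> : 2 * mass f f - 2 * form f f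
    = \sum_v \sum_u W u v * f u ^+ 2 + s - 2 * form f f.
  by rewrite -s'E sE; ring.
rewrite /s /form mulr_sumr -sumrN -!big_split; apply: eq_bigr => v _ /=.
by rewrite mulr_sumr -sumrN -!big_split; apply: eq_bigr => u _ /=; ring.
Qed.

(** Functions on [I] are coded as row vectors, for which compactness and the extreme value theorem
    are at hand. The quotient is maximised on [K]. *)
Let rv (r : 'rV[R]_#|I|) (v : I) : R := r ord0 (enum_rank v).
Let K : set 'rV[R]_#|I| := [set r | mean (rv r) = 0 /\ mass (rv r) (rv r) = 1]%classic.

Let continuous_rv v : continuous (fun r => rv r v).
Proof. exact: coord_continuous. Qed.

Let continuous_sum (J : finType) (F : J -> 'rV[R]_#|I| -> R) :
  (forall j, continuous (F j)) -> continuous (fun r => \sum_j F j r).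
Proof.
move=> cF r; have cadd : continuous (fun x : R * R => x.1 + x.2) by exact: add_continuous.
exact: (@cvg_big _ _ _ _ xpredT cadd _ (nbhs r) _ _ _ _ (fun j _ => cF j r)).
Qed.

Let continuous_mul (F G : 'rV[R]_#|I| -> R) :
  continuous F -> continuous G -> continuous (fun r => F r * G r).
Proof. by move=> cF cG r; exact: (continuousM (cF r) (cG r)). Qed.

Let continuous_cst (a : R) : continuous (fun _ : 'rV[R]_#|I| => a).
Proof. exact: cst_continuous. Qed.

Let continuous_mass : continuous (fun r => mass (rv r) (rv r)).
Proof. by apply: continuous_sum => v; do 2![apply: continuous_mul => //]. Qed.

Let continuous_mean : continuous (fun r => mean (rv r)).
Proof. by apply: continuous_sum => v; apply: continuous_mul. Qed.

Let continuous_form : continuous (fun r => form (rv r) (rv r)).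
Proof.
by do 2![apply: continuous_sum => ?]; do 2![apply: continuous_mul => //].
Qed.

Let K_compact : compact K.
Proof.
have K_closed : closed K.
  have -> : K = ((fun r => mean (rv r)) @^-1` [set x | x = 0] `&`
      (fun r => mass (rv r) (rv r)) @^-1` [set x | x = 1])%classic by [].
  apply: closedI; apply: preimage_closed; try exact: closed_eq.
    by move=> ? _; exact: continuous_mean.
  by move=> ? _; exact: continuous_mass.
apply: bounded_closed_compact => //.
pose M := 1 + \sum_v (D v)^-1.
have sum_ge0 : 0 <= \sum_v (D v)^-1 by apply: sumr_ge0 => v _; rewrite invr_ge0 ltW.
exists M; split=> [|y My r [_ r1]]; first exact: num_real.
apply: le_trans (ltW My).
rewrite /Num.norm/= mx_normrE; apply/bigmax_leP.
split=> [|[i j] _ /=]; first by rewrite addr_ge0.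
rewrite (ord1 i).
have := le_mass (rv r) (enum_val j); rewrite r1 /rv enum_valK => r_le.
have : (r ord0 j) ^+ 2 <= \sum_v (D v)^-1.
  rewrite (bigD1 (enum_val j))//= ler_wpDr//.
    by apply: sumr_ge0 => v _; rewrite invr_ge0 ltW.
  by rewrite -[leRHS]mul1r ler_pdivlMr// mulrC.
rewrite /M ler_norml; move: (r ord0 j) (\sum_v _) sum_ge0 => x z z0 xz.
by apply/andP; split; nra.
Qed.

(** Both sides are quadratic in [f], so [f] may be rescaled into [K]. *)
Let form_le_max (c f : I -> R) :
    (forall r, K r -> form (rv r) (rv r) <= form c c) ->
  mean f = 0 -> form f f <= form c c * mass f f.
Proof.
move=> c_max f0.
have [m0|m_neq0] := eqVneq (mass f f) 0.
  rewrite m0 mulr0 /form big1// => v _; rewrite big1// => u _.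
  by rewrite (mass_eq0 m0 v) mulr0.
have m_gt0 : 0 < mass f f by rewrite lt_neqAle eq_sym m_neq0 mass_ge0.
pose t := (Num.sqrt (mass f f))^-1.
have t2 : t ^+ 2 = (mass f f)^-1 by rewrite exprVn sqr_sqrtr// ltW.
pose r : 'rV[R]_#|I| := \row_j (t * f (enum_val j)).
have rE : rv r = (fun v => t * f v).
  by apply/funext => v; rewrite /rv mxE enum_rankK.
have /c_max : K r by rewrite /K /= rE meanZ f0 mulr0 massZ t2 mulVf.
by rewrite rE formZ t2 ler_pdivrMl// mulrC.
Qed.

(** The first variation at [c] makes the residual [h] orthogonal to every mean-zero function. As [h]
    sums to 0, [h / D] is such a function, and testing against it gives [h = 0]. *)
Let eigen_of_max c : mean c = 0 -> mass c c = 1 ->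
    (forall f, mean f = 0 -> form f f <= form c c * mass f f) ->
  forall v, \sum_u W u v * c u = form c c * D v * c v.
Proof.
move=> c0 c1 c_max; set a := form c c in c_max *.
pose h v := \sum_u W u v * c u - a * D v * c v.
have sum_h : \sum_v h v = 0.
  have -> : \sum_v h v = mean c - a * mean c; last by rewrite c0 mulr0 subrr.
  rewrite /h sumrB; congr (_ - _).
    rewrite exchange_big; apply: eq_bigr => v _ /=.
    by rewrite -mulr_suml; congr (_ * _); apply: eq_bigr => u _; rewrite W_sym.
  by rewrite /mean mulr_sumr; apply: eq_bigr => v _; rewrite mulrA.
have ort f : mean f = 0 -> \sum_v h v * f v = 0.
  move=> f0.
  suff: a * mass c f - form c f = 0.
    move=> /eqP; rewrite subr_eq0 => /eqP e.
    have -> : \sum_v h v * f v = form c f - a * mass c f; last first.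
      by rewrite e subrr.
    rewrite /form /mass mulr_sumr -sumrB; apply: eq_bigr => v _.
    by rewrite /h mulrBl mulr_suml; congr (_ - _); ring.
  apply: (@quadratic_ge0_linear_eq0 _ _ (a * mass f f - form f f)) => t.
  have : mean (fun v => c v + t * f v) = 0.
    have -> : mean (fun v => c v + t * f v) = mean c + t * mean f.
      rewrite /mean mulr_sumr -big_split; apply: eq_bigr => v _ /=; ring.
    by rewrite c0 f0 mulr0 addr0.
  move=> /c_max; rewrite formD massD c1 -/a; lra.
have : \sum_v h v * (h v / D v) = 0.
  apply: ort; rewrite -sum_h; apply: eq_bigr => v _.
  by rewrite mulrC divfK// gt_eqF.
have hD_ge0 v : 0 <= h v * (h v / D v).
  by rewrite mulrA -expr2 divr_ge0 ?sqr_ge0// ltW.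
move=> /eqP; rewrite psumr_eq0// => /allP h0 v; apply/eqP; rewrite -subr_eq0.
have := h0 v (mem_index_enum v); rewrite /= mulf_eq0 mulf_eq0 invr_eq0.
by rewrite (gt_eqF (D_gt0 v)) orbF orbb.
Qed.

Hypothesis W_connected : forall u v, connect [rel x y | 0 < W x y] u v.

(** The Dirichlet energy vanishes, so [f] agrees across every edge, hence along paths. *)
Let harmonic_constant f : form f f = mass f f -> forall u v, f u = f v.
Proof.
move=> f_eq.
have := mass_form f; rewrite f_eq subrr => sum0.
have edge x y : 0 < W x y -> f x = f y.
  move=> Wxy; have term_ge0 u v : 0 <= W u v * (f u - f v) ^+ 2.
    by apply: mulr_ge0 => //; exact: sqr_ge0.
  move/eqP: sum0; rewrite psumr_eq0 => [|v _]; last exact: sumr_ge0.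
  move=> /allP/(_ y (mem_index_enum y))/=; rewrite psumr_eq0//.
  move=> /allP/(_ x (mem_index_enum x))/=.
  by rewrite mulf_eq0 gt_eqF//= sqrf_eq0 subr_eq0 => /eqP.
move=> u v; have /connectP[p] := W_connected u v.
elim: p u => [u _ ->//|w p IH u /= /andP[uw wp] v_last].
by rewrite (edge _ _ uw) (IH w).
Qed.

(* A maximiser of the Rayleigh quotient among mean-zero functions is an
   eigenfunction, whose eigenvalue is not 1 because the graph is connected. *)
Lemma spectral_gap_form (lam : R) :
    (forall a (f : I -> R), (exists v, f v != 0) ->
      (forall v, \sum_u W u v * f u = a * D v * f v) -> a <= lam \/ a = 1) ->
  forall f : I -> R, \sum_v D v * f v = 0 ->
    \sum_v \sum_u W u v * f u * f v <= lam * \sum_v D v * f v * f v.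
Proof.
move=> spec f f0; rewrite -/(form f f) -/(mass f f).
have [m0|m_neq0] := eqVneq (mass f f) 0.
  rewrite m0 mulr0 /form big1// => v _; rewrite big1// => u _.
  by rewrite (mass_eq0 m0 v) mulr0.
have m_gt0 : 0 < mass f f by rewrite lt_neqAle eq_sym m_neq0 mass_ge0.
have K_neq0 : (K !=set0)%classic.
  pose t := (Num.sqrt (mass f f))^-1.
  exists (\row_j (t * f (enum_val j))).
  rewrite /K /= (_ : rv _ = fun v => t * f v); last first.
    by apply/funext => v; rewrite /rv mxE enum_rankK.
  by rewrite meanZ massZ /mean f0 mulr0 exprVn sqr_sqrtr ?mulVf.
have [r /[!inE] -[r0 r1] r_max] := @EVT_max_rV R _ (fun r => form (rv r) (rv r)) _
  K_neq0 K_compact (continuous_subspaceT continuous_form).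
set c := rv r in r0 r1 r_max.
have c_max g : mean g = 0 -> form g g <= form c c * mass g g.
  by apply: form_le_max => s Ks; apply: r_max; rewrite inE.
have c_eigen := eigen_of_max r0 r1 c_max.
have [v cv] : exists v, c v != 0.
  apply/not_existsP => c0.
  have : mass c c = 0.
    by rewrite /mass big1// => v _; move/negP: (c0 v); rewrite negbK => /eqP->; rewrite mulr0.
  by move/eqP; rewrite r1 oner_eq0.
have [le_lam|c_eq1] := spec _ _ (ex_intro _ v cv) c_eigen.
  by apply: le_trans (c_max f f0) _; rewrite ler_wpM2r.
(* For eigenvalue 1 the nonzero [c] would be constant with mean zero, although the total degree is
   positive. *)
have c_cst := harmonic_constant (etrans c_eq1 (esym r1)).
move: r0; rewrite /mean (eq_bigr (fun u => D u * c v)) => [|u _]; last first.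
  by rewrite (c_cst u v).
rewrite -mulr_suml => /eqP; rewrite mulf_eq0 (negPf cv) orbF => /eqP D0.
have := D_gt0 v; rewrite ltNge -D0 (bigD1 v)//= lerDl sumr_ge0// => u _.
exact: ltW.
Qed.

End WeightedGraph.

(** * Double counting in links and the gap of their walks *)

Section Links.
Import boot.fintype boot.finset.
Variables (R : realType) (V : finType) (n : nat) (X : {set {set V}}).
Hypotheses (X_complex : simplicial_complex X) (X_pure : pure n X).
Implicit Types (s t tau : {set V}) (u v : V).

Local Notation top := (faces X n.+1).
Local Notation deg := (top_degree n X).

Lemma top_card s : s \in top -> #|s| = n.+1.
Proof. by rewrite inE => /andP[_ /eqP]. Qed.

Lemma mem_complexE t : (t \in X) = (0 < deg t)%N.
Proof.
apply/idP/card_gt0P => [/X_pure[s sT ts]|[s]]; first by exists s; rewrite inE sT.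
by rewrite !inE => /andP[/andP[sX _]]; apply: X_complex.2.
Qed.

Lemma top_degreeE t : (deg t)%:R = \sum_(s in top | t \subset s) (1 : R).
Proof. by rewrite sumr_const /top_degree cardsE. Qed.

Lemma in_vertices_link tau v :
  (v \in vertices (link X tau)) = (v \notin tau) && (v |: tau \in X).
Proof.
rewrite !inE cards1 eqxx andbT [tau :|: _]setUC cardsU1 addn1.
case: (v \in tau) => /=; first by rewrite eqn_leq ltnn !andbF.
rewrite add1n eqxx andbT andb_idl// => vtauX.
by apply: X_complex.2 vtauX _; rewrite sub1set setU11.
Qed.

Lemma in_edges_link tau u v :
  ([set u; v] \in faces (link X tau) 2) =
  [&& u != v, u \notin tau, v \notin tau & tau :|: [set u; v] \in X].
Proof.
rewrite !inE cards2 eqSS eqb1.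
case: (eqVneq u v) => [_|uv] /=; first by rewrite !andbF.
rewrite andbT.
have -> : (#|tau :|: [set u; v]| == #|tau| + 2)%N = (u \notin tau) && (v \notin tau).
  rewrite cardsU cards2 uv -[X in _ == X]subn0 eqn_sub2lE ?leq0n//; last first.
    by rewrite (leq_trans (subset_leq_card (subsetIl _ _)))// leq_addr.
  rewrite cards_eq0 -subset0; apply/subsetP/andP => [sub|[utau vtau] x].
    by split; apply/negP => h; [have := sub u|have := sub v];
      rewrite !inE h eqxx ?orbT => /(_ isT).
  by rewrite !inE => /andP[xtau /orP[]/eqP xE]; move: utau vtau; rewrite -xE xtau.
apply/and3P/and3P => [[_ h /andP[]]|[utau vtau h]] //.
by split; rewrite ?utau//; exact: X_complex.2 h (subsetUr _ _).
Qed.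

(** Double counting of pairs [(v, s)]: the link vertices lying in a top simplex [s] over [tau] are
    exactly the vertices of [s] outside [tau]. *)
Lemma sum_vertices_link tau (F : V -> {set V} -> R) :
  \sum_(v in vertices (link X tau)) \sum_(s in top | v |: tau \subset s) F v s =
  \sum_(s in top | tau \subset s) \sum_(v in s :\: tau) F v s.
Proof.
rewrite (exchange_big_dep (fun s => (s \in top) && (tau \subset s))) /=; last first.
  by move=> v s _ /andP[-> /=]; apply: subset_trans; exact: subsetUr.
apply: eq_bigr => s /andP[sT taus]; apply: eq_bigl => v.
rewrite in_vertices_link sT subUset sub1set taus andbT/= in_setD.
case: (v \in tau) => //=; rewrite andb_idl// => vs.
have := sT; rewrite inE => /andP[sX _].
by apply: X_complex.2 sX _; rewrite subUset sub1set vs.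
Qed.

Lemma sum_neighbours_link tau v (F : V -> {set V} -> R) :
  v \in vertices (link X tau) ->
  \sum_(u in vertices (link X tau) | u != v)
    \sum_(s in top | tau :|: [set u; v] \subset s) F u s =
  \sum_(s in top | v |: tau \subset s) \sum_(u in s :\: tau | u != v) F u s.
Proof.
move=> vL.
rewrite (exchange_big_dep (fun s => (s \in top) && (v |: tau \subset s))) /=; last first.
  move=> u s _ /andP[->]; rewrite !subUset !sub1set => /andP[-> /andP[_ ->]].
  by [].
apply: eq_bigr => s /andP[sT]; rewrite subUset sub1set => /andP[vs taus].
apply: eq_bigl => u; rewrite !subUset !sub1set sT taus vs/= andbT.
rewrite in_vertices_link in_setD.
case: (u \in tau) => //=; rewrite -andbA andbC -andbA; case: (u != v); rewrite ?andbF//=.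
rewrite andb_idr ?andbT// => us.
have := sT; rewrite inE => /andP[sX _].
by apply: X_complex.2 sX _; rewrite subUset sub1set us.
Qed.

Lemma sum_edges_link tau (F : V -> V -> {set V} -> R) :
  \sum_(v in vertices (link X tau)) \sum_(u in vertices (link X tau) | u != v)
    \sum_(s in top | tau :|: [set u; v] \subset s) F u v s =
  \sum_(s in top | tau \subset s) \sum_(v in s :\: tau)
    \sum_(u in s :\: tau | u != v) F u v s.
Proof.
rewrite -sum_vertices_link; apply: eq_bigr => v vL.
exact: sum_neighbours_link.
Qed.

Section Gap.
Variables (lam : R) (tau : {set V}).
Hypothesis tau_small : (#|tau| < n)%N.
Hypothesis tau_connected : skeleton_connected (link X tau).
Hypothesis tau_spec : (walk_spectrum R n X tau `<=` `[-1, lam] `|` [set 1])%classic.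

Let I := link_vertex X tau.
(** The link weights of edges without their common factor [(n - #|tau| - 1)!], and with zero
    diagonal. *)
Let W (u v : I) : R :=
  if val u == val v then 0 else (deg (tau :|: [set val u; val v]))%:R.

Let W_sum (F : V -> V -> R) :
  \sum_(v : I) \sum_(u : I) W u v * F (val u) (val v) =
  \sum_(s in top | tau \subset s) \sum_(v in s :\: tau)
    \sum_(u in s :\: tau | u != v) F u v.
Proof.
rewrite -sum_edges_link [RHS]big_sub; apply: eq_bigr => v _.
rewrite [RHS]big_sub_cond [RHS]big_mkcond; apply: eq_bigr => u _ /=.
rewrite /W; case: eqP => [_|_] /=; first by rewrite mul0r.
by rewrite top_degreeE mulr_suml; apply: eq_bigr => s _; rewrite mul1r.
Qed.

(** A top simplex over [v |: tau] has [n - #|tau|] further vertices, each of them a neighbour of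
    [v]. *)
Let D_sum (v : I) : \sum_(u : I) W u v = (n - #|tau|)%:R * (deg (val v |: tau))%:R.
Proof.
have -> : \sum_(u : I) W u v =
    \sum_(u in vertices (link X tau) | u != val v)
      \sum_(s in top | tau :|: [set u; val v] \subset s) (1 : R).
  rewrite [RHS]big_sub_cond [RHS]big_mkcond; apply: eq_bigr => u _ /=.
  by rewrite /W; case: eqP => //= _; rewrite top_degreeE.
rewrite sum_neighbours_link ?(valP v)// top_degreeE mulr_sumr.
apply: eq_bigr => s /andP[/top_card s_card vs]; rewrite mulr1 sumr_const; congr _%:R.
have /andP[vtau _] : (val v \notin tau) && (val v |: tau \in X).
  by rewrite -in_vertices_link (valP v).
have := cardsD s (val v |: tau); rewrite (setIidPr vs) s_card cardsU1 vtau subSS => <-.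
apply: eq_card => u; rewrite -topredE /= !inE.
by case: (u \in s); case: (u == val v); case: (u \in tau).
Qed.

Let D_mean (F : V -> R) : \sum_(v : I) (\sum_(u : I) W u v) * F (val v) =
  (n - #|tau|)%:R * \sum_(s in top | tau \subset s) \sum_(v in s :\: tau) F v.
Proof.
rewrite -sum_vertices_link [in RHS]big_sub mulr_sumr; apply: eq_bigr => v _.
by rewrite D_sum top_degreeE -mulrA mulr_suml; congr (_ * _);
  apply: eq_bigr => s _; rewrite mul1r.
Qed.

Let D_gt0 (v : I) : 0 < \sum_(u : I) W u v.
Proof.
rewrite D_sum mulr_gt0// ltr0n ?subn_gt0// -mem_complexE.
by have := valP v; rewrite in_vertices_link => /andP[].
Qed.

Let W_sym (u v : I) : W u v = W v u.
Proof. by rewrite /W eq_sym (setUC [set val u]). Qed.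

Let W_ge0 (u v : I) : 0 <= W u v.
Proof. by rewrite /W; case: eqP. Qed.

Let W_edge (u v : I) : (0 < W u v) = ([set val u; val v] \in faces (link X tau) 2).
Proof.
have := valP u; have := valP v; rewrite in_edges_link !in_vertices_link.
move=> /andP[-> _] /andP[-> _] /=.
by rewrite /W; case: eqP => _ /=; rewrite ?ltxx// ltr0n -mem_complexE.
Qed.

Let W_connected (u v : I) : connect [rel x y | 0 < W x y] u v.
Proof.
have /connectP[p] := tau_connected (valP u) (valP v).
elim: p u => [u _ /val_inj->|w p IH u /= /andP[uw wp] v_last]; first exact: connect0.
have wL : w \in vertices (link X tau).
  move: uw; rewrite in_edges_link in_vertices_link => /and4P[_ _ -> uwX] /=.
  apply: X_complex.2 uwX _.
  by rewrite setUC setUS// subsetUr.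
pose w' : I := exist _ w wL.
apply: (@connect_trans _ _ w'); last exact: IH.
by apply: connect1; rewrite /= W_edge.
Qed.

(** Dividing by the degrees gives an eigenfunction of [walk]: the quotient of the factorials in the
    edge and vertex weights is the factor [n - #|tau|] of [D_sum]. *)
Let W_spec a (f : I -> R) : (exists v : I, f v != 0) ->
  (forall v : I, \sum_u W u v * f u = a * (\sum_u W u v) * f v) -> a <= lam \/ a = 1.
Proof.
move=> [v0 fv0] f_eigen.
have /tau_spec[] : walk_spectrum R n X tau a; last by move=> /=; right.
  apply/walk_spectrumP; exists [ffun v : I => f v : R^o].
    by apply: contraNneq fv0 => /ffunP/(_ v0); rewrite !ffunE => /eqP.
  apply/ffunP => v; rewrite !ffunE /GRing.scale /=.
  have D_neq0 := lt0r_neq0 (D_gt0 v).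
  apply: (mulfI D_neq0); rewrite mulrCA mulrA -f_eigen mulr_sumr big_mkcond.
  apply: eq_bigr => u _; rewrite ffunE -W_edge.
  have := W_ge0 u v; rewrite le_eqVlt => /predU1P[<-|Wuv]; first by rewrite ltxx mul0r.
  rewrite Wuv mulrA; congr (_ * _).
  have := Wuv; rewrite W_edge in_edges_link => /and4P[uv utau vtau _].
  rewrite D_sum /W (negPf uv) /link_weight /weight.
  have -> : #|tau :|: [set val u; val v]| = #|tau|.+2.
    rewrite setUC -setUA cardsU1 cardsU1 !inE (negPf uv) (negPf utau) vtau.
    by rewrite add1n.
  have -> : #|tau :|: [set val v]| = #|tau|.+1 by rewrite setUC cardsU1 vtau.
  move: D_neq0; rewrite D_sum setUC => D_neq0; rewrite !subSS.
  have -> : (n - #|tau| = (n - #|tau|.+1).+1)%N by rewrite subnSK.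
  move: D_neq0; rewrite -(subnSK tau_small) factS !natrM; set m := (n - _)%N.
  move=> D_neq0; have m_neq0 : (m`!%:R : R) != 0 by rewrite pnatr_eq0 -lt0n fact_gt0.
  move: D_neq0; rewrite mulf_eq0 negb_or => /andP[m1_neq0 d_neq0].
  by field; rewrite d_neq0 m_neq0 nat1r m1_neq0.
by rewrite /= in_itv/= => /andP[_ ?]; left.
Qed.

(** In the expanded square the off-diagonal terms form the quadratic form of the walk. The gap
    bounds it by [lam] times the mass, which carries the factor [n - #|tau|] of [D_sum]. *)
Lemma link_gap (phi : V -> R) :
  \sum_(s in top | tau \subset s) \sum_(v in s :\: tau) phi v = 0 ->
  \sum_(s in top | tau \subset s) (\sum_(v in s :\: tau) phi v) ^+ 2 <=
  (1 + (n - #|tau|)%:R * lam) *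
    \sum_(s in top | tau \subset s) \sum_(v in s :\: tau) phi v ^+ 2.
Proof.
move=> phi0.
have := spectral_gap_form W_sym W_ge0 D_gt0 W_connected W_spec (f := phi \o val).
rewrite (D_mean phi) phi0 mulr0 => /(_ erefl).
under eq_bigr do under eq_bigr do rewrite -mulrA.
under [X in _ <= _ * X]eq_bigr do rewrite -mulrA.
rewrite (W_sum (fun u v => phi u * phi v)) (D_mean (fun v => phi v * phi v)).
rewrite mulrA [lam * _]mulrC mulrDl mul1r => h.
have -> : \sum_(s in top | tau \subset s) (\sum_(v in s :\: tau) phi v) ^+ 2 =
  \sum_(s in top | tau \subset s) \sum_(v in s :\: tau) phi v ^+ 2 +
  \sum_(s in top | tau \subset s) \sum_(v in s :\: tau)
    \sum_(u in s :\: tau | u != v) phi u * phi v.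
  rewrite -big_split; apply: eq_bigr => s _ /=.
  rewrite expr2 mulr_sumr -big_split; apply: eq_bigr => v vs /=.
  by rewrite (bigD1 v)//= mulrDl -expr2 mulr_suml.
by rewrite lerD2l.
Qed.

End Gap.
End Links.

(** * Conditional expectations along the colors of a partite complex *)

Section Partite.
Import boot.fintype boot.finset.
Variables (R : realType) (V : finType) (n : nat) (X : {set {set V}}).
Variables (S : 'I_n.+1 -> {set V}) (lam : R).
Hypotheses (X_complex : simplicial_complex X) (X_pure : pure n X).
Hypothesis X_connected : connected_links n X.
Hypothesis X_partite : partite n X S.
Hypothesis lam_gt0 : 0 < lam.
Hypothesis X_spec : forall (k : nat) (tau : {set V}), (k < n)%N ->
  tau \in faces X k ->
  (walk_spectrum R n X tau `<=` `[-1, lam] `|` [set 1])%classic.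
Implicit Types (s t tau : {set V}) (u v : V) (f g : V -> R) (i : 'I_n.+1).

Local Notation top := (faces X n.+1).
Local Notation deg := (top_degree n X).

(* A top simplex s has exactly one vertex of color i, and this is the value of f
   at that vertex. *)
Definition value f i s : R := \sum_(v in s :&: S i) f v.

(** Conditioning on [initial j s] is conditioning on the vertices of the first [j] colors. *)
Definition initial (j : nat) s : {set V} := s :&: \bigcup_(i : 'I_n.+1 | (i < j)%N) S i.

(** The conditional expectation of [G] on the star of [tau], for the uniform measure on top
    simplices. *)
Definition star_mean (G : {set V} -> R) tau : R :=
  (\sum_(s in top | tau \subset s) G s) / (deg tau)%:R.

Lemma side_vertex s i : s \in top -> exists v, s :&: S i = [set v].
Proof. by case: X_partite => _ _ h /(h s i)/eqP/cards1P. Qed.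

Lemma value1 f i s v : s :&: S i = [set v] -> value f i s = f v.
Proof. by rewrite /value => ->; rewrite big_set1. Qed.

Lemma sides_disjoint i1 i2 v : v \in S i1 -> v \in S i2 -> i1 = i2.
Proof.
case: X_partite => dis _ _ v1 v2; apply/eqP/negPn/negP => /dis.
by move/pred0P/(_ v); rewrite /= v1 v2.
Qed.

Lemma in_initial j s i v : v \in S i -> (v \in initial j s) = (v \in s) && (i < j)%N.
Proof.
move=> vi; rewrite inE; congr (_ && _); apply/bigcupP/idP => [[i' ij vi']|ij].
  by rewrite (sides_disjoint vi vi').
by exists i.
Qed.

Lemma initial_subset j s : initial j s \subset s.
Proof. exact: subsetIl. Qed.

Lemma initial0 s : initial 0 s = set0.
Proof. by rewrite /initial big_pred0 ?setI0. Qed.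

Lemma initialS (i : 'I_n.+1) s : initial i.+1 s = initial i s :|: (s :&: S i).
Proof.
rewrite /initial (bigD1 i)//= setIUr setUC; congr (_ :&: _ :|: _).
by apply: eq_bigl => i'; rewrite ltnS andbC -ltn_neqAle.
Qed.

Lemma initial_face j s : (j <= n.+1)%N -> s \in top -> initial j s \in faces X j.
Proof.
move=> jn sT; have sX : s \in X by move: sT; rewrite inE => /andP[].
rewrite inE (X_complex.2 _ _ sX (initial_subset _ _))/=.
elim: j jn => [|j IH] jn; first by rewrite initial0 cards0.
rewrite (initialS (Ordinal jn)) /=; have [v sv] := side_vertex (Ordinal jn) sT.
have : v \in s :&: S (Ordinal jn) by rewrite sv set11.
rewrite inE => /andP[vs vS].
rewrite sv setUC cardsU1 (in_initial _ _ vS) vs ltnn/= add1n eqSS.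
by apply: IH; exact: ltnW.
Qed.

(** Both initial faces have [j] vertices, so inclusion is equality. Hence the stars of the initial
    faces partition the top simplices. *)
Lemma sub_initial j s0 s : (j <= n.+1)%N -> s0 \in top -> s \in top ->
  (initial j s0 \subset s) = (initial j s == initial j s0).
Proof.
move=> jn s0T sT; apply/idP/eqP => [sub|<-]; last exact: initial_subset.
apply/esym/eqP; rewrite eqEcard subsetI sub subsetIr/=.
have := initial_face jn sT; have := initial_face jn s0T.
by rewrite !inE => /andP[_ /eqP->] /andP[_ /eqP->].
Qed.

Lemma sum_initial j (F : {set V} -> R) : (j <= n.+1)%N ->
  \sum_(s in top) F s =
  \sum_(tau in initial j @: top) \sum_(s in top | tau \subset s) F s.
Proof.
move=> jn; rewrite (partition_big_imset (initial j)) /=.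
apply: eq_bigr => tau /imsetP[s0 s0T ->]; apply: eq_bigl => s.
by case: (boolP (s \in top)) => // sT; rewrite sub_initial.
Qed.

(** Sorts the top simplices over [tau] by their vertex of color [i]. *)
Lemma sum_value tau f i (K : {set V} -> R) :
  \sum_(s in top | tau \subset s) value f i s * K s =
  \sum_(v in S i) f v * \sum_(s in top | v |: tau \subset s) K s.
Proof.
under [RHS]eq_bigr do rewrite mulr_sumr.
rewrite (exchange_big_dep (fun s => (s \in top) && (tau \subset s))) /=; last first.
  by move=> v s _ /andP[-> /=]; apply: subset_trans; exact: subsetUr.
apply: eq_bigr => s /andP[sT taus]; rewrite /value mulr_suml; apply: eq_bigl => v.
by rewrite subUset sub1set inE sT taus andbT andbC.
Qed.

(** This includes [deg tau = 0], where the sum is empty. *)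
Lemma star_meanE G tau :
  \sum_(s in top | tau \subset s) G s = (deg tau)%:R * star_mean G tau.
Proof.
rewrite /star_mean mulrC; have [d0|/negPf d_neq0] := eqVneq (deg tau) 0%N; last first.
  by rewrite divfK ?pnatr_eq0 ?d_neq0.
rewrite d0 mulr0 big1// => s sP; move/eqP: d0; rewrite cards_eq0 => /eqP/setP/(_ s).
by rewrite !inE -andbA; move: sP; rewrite inE -andbA => ->.
Qed.

(** As [j <= i], removing the initial face removes no vertex of color [i]. *)
Lemma sum_value_link j s0 f i s : (j <= i)%N ->
  \sum_(v in s :\: initial j s0) (if v \in S i then f v else 0) = value f i s.
Proof.
move=> ji; rewrite -big_mkcondr; apply: eq_bigl => v; rewrite !inE.
case vi: (v \in S i); rewrite ?andbF// !andbT.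
by have := in_initial j s0 vi; rewrite !inE ltnNge ji andbF => ->.
Qed.

(* Apply the spectral gap of the link of [initial j s0] to the sum of a multiple
   of [star_mean] on side j and of g on side k, both centered. *)
Lemma star_mean_step (j k : 'I_n.+1) g s0 : (j < k)%N -> s0 \in top ->
  \sum_(s in top | initial j s0 \subset s)
      star_mean (value g k) (initial j.+1 s) ^+ 2 <=
  \sum_(s in top | initial j s0 \subset s)
      star_mean (value g k) (initial j s) ^+ 2 +
    ((n - j)%:R * lam) ^+ 2 *
      \sum_(s in top | initial j s0 \subset s) value g k s ^+ 2.
Proof.
move=> jk s0T; set tau := initial j s0; set G := value g k.
have jn : (j < n)%N by rewrite (leq_trans jk)// -ltnS.
have jn1 : (j <= n.+1)%N by rewrite ltnW.
have tau_face : tau \in faces X j by exact: initial_face.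
have [tauX /eqP tau_card] : tau \in X /\ #|tau| == j.
  by move: tau_face; rewrite inE => /andP[].
have gap := @link_gap R V n X X_complex X_pure lam tau.
rewrite tau_card in gap.
have {}gap := gap jn (X_connected jn tau_face) (X_spec jn tau_face).
set c := star_mean G tau.
(* [F] is the martingale increment when the vertex of color [j] is revealed, and [H] is [G] minus
   its conditional mean. *)
pose a v := star_mean G (v |: tau) - c.
pose F := value a j; pose H := value (fun v => g v - c) k.
pose e := (n - j)%:R * lam.
have e_gt0 : 0 < e by rewrite mulr_gt0// ltr0n subn_gt0.
have FE s : s \in top -> tau \subset s -> F s = star_mean G (initial j.+1 s) - c.
  move=> sT taus; have [v sv] := side_vertex j sT.
  rewrite /F (value1 _ sv) /a; congr (star_mean G _ - _).
  rewrite initialS sv setUC; congr (_ :|: _).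
  by apply/esym/eqP; rewrite -sub_initial.
have HE s : s \in top -> H s = G s - c.
  by move=> sT; have [v sv] := side_vertex k sT; rewrite /H /G !(value1 _ sv).
have sumH t : \sum_(s in top | t \subset s) H s = (deg t)%:R * (star_mean G t - c).
  rewrite mulrBr -star_meanE top_degreeE mulr_suml -sumrB.
  by apply: eq_bigr => s /andP[sT _]; rewrite HE// mul1r.
have H0 : \sum_(s in top | tau \subset s) H s = 0 by rewrite sumH subrr mulr0.
have F0 : \sum_(s in top | tau \subset s) F s = 0.
  under eq_bigr do rewrite -[F _]mulr1; rewrite sum_value -[RHS]H0.
  transitivity (\sum_(s in top | tau \subset s) value (fun=> 1) j s * H s).
    rewrite sum_value; apply: eq_bigr => v _.
    by rewrite mul1r sumH top_degreeE mulrC.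
  apply: eq_bigr => s /andP[sT _]; have [v sv] := side_vertex j sT.
  by rewrite (value1 _ sv) mul1r.
(* [F] is the conditional expectation of [H] given the vertex of color [j], that is, an orthogonal
   projection of [H]. *)
have FH : \sum_(s in top | tau \subset s) F s * H s =
    \sum_(s in top | tau \subset s) F s ^+ 2.
  rewrite sum_value.
  transitivity (\sum_(s in top | tau \subset s) value (fun v => a v * a v) j s * 1).
    rewrite sum_value; apply: eq_bigr => v _.
    by rewrite sumH -top_degreeE -/(a v); ring.
  apply: eq_bigr => s /andP[sT _]; have [v sv] := side_vertex j sT.
  by rewrite /F !(value1 _ sv) mulr1 expr2.
(* With [A] and [B] the sums of [F ^+ 2] and [H ^+ 2], the gap reads [e^-2 A + 2 e^-1 A + B <= (1 +
   e) (e^-2 A + B)]. The scale [e^-1] turns this into [A <= e^2 B]. *)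
pose phi v := (if v \in S j then e^-1 * a v else 0) + (if v \in S k then g v - c else 0).
have phiE s : \sum_(v in s :\: tau) phi v = e^-1 * F s + H s.
  rewrite big_split/= !sum_value_link ?(ltnW jk)//; congr (_ + _).
  by rewrite /F /value mulr_sumr.
have phi2E s : s \in top ->
    \sum_(v in s :\: tau) phi v ^+ 2 = e^-1 ^+ 2 * F s ^+ 2 + H s ^+ 2.
  move=> sT; transitivity (value (fun v => (e^-1 * a v) ^+ 2) j s
      + value (fun v => (g v - c) ^+ 2) k s).
    rewrite -(sum_value_link s0 _ s (leqnn j)) -(sum_value_link s0 _ s (ltnW jk)).
    rewrite -big_split; apply: eq_bigr => v _ /=; rewrite /phi.
    case vj: (v \in S j); case vk: (v \in S k); rewrite ?addr0 ?add0r ?expr0n//.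
    by move: jk; rewrite (sides_disjoint vj vk) ltnn.
  have [vj svj] := side_vertex j sT; have [vk svk] := side_vertex k sT.
  by rewrite /F /H !(value1 _ svj) !(value1 _ svk) exprMn.
have := gap phi; under eq_bigr do rewrite phiE.
rewrite big_split/= -mulr_sumr F0 H0 mulr0 addr0 => /(_ erefl).
under eq_bigr do rewrite phiE.
under [X in _ <= _ * X]eq_bigr => s /andP[sT _] do rewrite phi2E//.
rewrite -/e big_split/= -mulr_sumr.
have -> : \sum_(s in top | tau \subset s) (e^-1 * F s + H s) ^+ 2 =
    e^-1 ^+ 2 * \sum_(s in top | tau \subset s) F s ^+ 2
    + 2 * e^-1 * \sum_(s in top | tau \subset s) F s ^+ 2
    + \sum_(s in top | tau \subset s) H s ^+ 2.
  rewrite -[in X in _ + X + _]FH !mulr_sumr -!big_split.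
  by apply: eq_bigr => s _ /=; ring.
(* Pythagoras: [F] is centered, so the cross term with the constant [c] vanishes. *)
have -> : \sum_(s in top | tau \subset s) star_mean G (initial j.+1 s) ^+ 2 =
    \sum_(s in top | tau \subset s) F s ^+ 2
    + \sum_(s in top | tau \subset s) c ^+ 2.
  transitivity (\sum_(s in top | tau \subset s) (F s ^+ 2 + c ^+ 2 + 2 * c * F s)).
    by apply: eq_bigr => s /andP[sT taus]; rewrite FE//; ring.
  by rewrite !big_split/= -[X in _ + X]mulr_sumr F0 mulr0 addr0.
have -> : \sum_(s in top | tau \subset s) star_mean G (initial j s) ^+ 2 =
    \sum_(s in top | tau \subset s) c ^+ 2.
  apply: eq_bigr => s /andP[sT]; rewrite /c /tau.
  by rewrite sub_initial// => /eqP->.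
have H2_le : \sum_(s in top | tau \subset s) H s ^+ 2 <=
    \sum_(s in top | tau \subset s) G s ^+ 2.
  have -> : \sum_(s in top | tau \subset s) G s ^+ 2 =
     \sum_(s in top | tau \subset s) (H s ^+ 2 + c ^+ 2 + 2 * c * H s).
    by apply: eq_bigr => s /andP[sT _]; rewrite HE//; ring.
  rewrite !big_split/= -[X in _ + X]mulr_sumr H0 mulr0 addr0 lerDl.
  by apply: sumr_ge0 => s _; exact: sqr_ge0.
move: H2_le; set A := \sum_(s in top | _) F s ^+ 2; set B := \sum_(s in top | _) H s ^+ 2.
move=> BG gap_AB; rewrite addrC lerD2l.
apply: le_trans (_ : e ^+ 2 * B <= _); last by rewrite ler_wpM2l// sqr_ge0.
have : e^-1 * A <= e * B.
  have eV : e * e^-1 = 1 by rewrite divff// gt_eqF.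
  have : e * (e^-1 ^+ 2 * A) = e^-1 * A by rewrite expr2 !mulrA eV mul1r.
  move: gap_AB; move: (e^-1) => e'; nra.
by move=> ?; rewrite expr2 -mulrA -ler_pdivrMl.
Qed.


Lemma star_mean_initialS (j k : 'I_n.+1) g : (j < k)%N ->
  \sum_(s in top) star_mean (value g k) (initial j.+1 s) ^+ 2 <=
  \sum_(s in top) star_mean (value g k) (initial j s) ^+ 2 +
    ((n - j)%:R * lam) ^+ 2 * \sum_(s in top) value g k s ^+ 2.
Proof.
move=> jk; have jn : (j <= n.+1)%N by exact: ltnW.
do 3 rewrite (sum_initial _ jn); rewrite mulr_sumr -big_split.
apply: ler_sum => tau /imsetP[s0 s0T ->] /=.
exact: star_mean_step.
Qed.

(** Adds up [j] increments, each factor [n - i] being at most [n]. The start is 0 because the star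
    of the empty face is everything and [g] has global mean zero. *)
Lemma star_mean_bound (j : nat) (k : 'I_n.+1) g : (j <= k)%N ->
  \sum_(s in top) value g k s = 0 ->
  \sum_(s in top) star_mean (value g k) (initial j s) ^+ 2 <=
  j%:R * (n%:R * lam) ^+ 2 * \sum_(s in top) value g k s ^+ 2.
Proof.
move=> + g0; elim: j => [_|j IH jk].
  rewrite !mul0r big1// => s _.
  rewrite initial0 /star_mean (eq_bigl (mem top)) => [|t]; last by rewrite sub0set andbT.
  by rewrite g0 mul0r expr0n.
have jn : (j < n.+1)%N by rewrite (ltn_trans jk).
apply: le_trans (star_mean_initialS (j := Ordinal jn) g jk) _.
rewrite -natr1 mulrDl mul1r mulrDl; apply: lerD; first exact/IH/ltnW.
apply: ler_wpM2r; first by apply: sumr_ge0 => s _; exact: sqr_ge0.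
rewrite lerXn2r ?nnegrE ?mulr_ge0 ?(ltW lam_gt0)//.
by rewrite ler_wpM2r ?(ltW lam_gt0)// ler_nat leq_subr.
Qed.

(** The tower property: the first factor is constant on the star of each initial face. *)
Lemma sum_star_mean (j : nat) (F G : {set V} -> R) : (j <= n.+1)%N ->
  \sum_(s in top) F (initial j s) * G s =
  \sum_(s in top) F (initial j s) * star_mean G (initial j s).
Proof.
move=> jn; do 2 rewrite (sum_initial _ jn).
apply: eq_bigr => tau /imsetP[s0 s0T ->].
have in_star s : s \in top -> initial j s0 \subset s -> initial j s = initial j s0.
  by move=> sT; rewrite sub_initial// => /eqP.
transitivity (F (initial j s0) * \sum_(s in top | initial j s0 \subset s) G s).
  by rewrite mulr_sumr; apply: eq_bigr => s /andP[sT /(in_star _ sT)->].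
rewrite star_meanE top_degreeE mulr_suml mulr_sumr.
by apply: eq_bigr => s /andP[sT /(in_star _ sT)->]; rewrite mul1r.
Qed.

Section Mixing.
Variables (P : R) (f : 'I_n.+1 -> V -> R).
Hypotheses (P_ge0 : 0 <= P) (P_le1 : P <= 1).
Hypothesis f_ge0 : forall i v, 0 <= f i v.
Hypothesis f_le1 : forall i v, f i v <= 1.
Hypothesis f_mean : forall i, \sum_(s in top) value (f i) i s = P * #|top|%:R.

Let F (j : nat) s := \prod_(i : 'I_n.+1 | (i < j)%N) value (f i) i s.

Let value_in01 i s : s \in top -> 0 <= value (f i) i s <= 1.
Proof. by move=> sT; have [v sv] := side_vertex i sT; rewrite (value1 _ sv) f_ge0 f_le1. Qed.

Let F_in01 j s : s \in top -> 0 <= F j s <= 1.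
Proof.
move=> sT; apply/andP; split.
  by apply: prodr_ge0 => i _; have /andP[] := value_in01 i sT.
by apply: prodr_ile1 => i _; exact: value_in01.
Qed.

Let F_initial j s : F j (initial j s) = F j s.
Proof.
apply: eq_bigr => i ij; apply: eq_bigl => v; rewrite !inE.
case vi: (v \in S i); rewrite ?andbF// !andbT.
by have := in_initial j s vi; rewrite !inE ij andbT => ->.
Qed.

Let FS (k : 'I_n.+1) s : F k.+1 s = F k s * value (f k) k s.
Proof.
rewrite /F (bigD1 k)//= mulrC; congr (_ * _); apply: eq_bigl => i.
by rewrite ltnS andbC -ltn_neqAle.
Qed.

Let F_le j s : (0 < j)%N -> s \in top -> F j s <= value (f ord0) ord0 s.
Proof.
move=> j_gt0 sT; rewrite /F (bigD1 ord0)//=.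
have /andP[v_ge0 _] := value_in01 ord0 sT.
rewrite ler_piMr//; apply: prodr_ile1 => i _; exact: value_in01.
Qed.

(* The error is a covariance, bounded by Cauchy-Schwarz in the form
   [2 |x y| <= e x^2 + y^2 / e]. *)
Let F_step (k : 'I_n.+1) : (0 < k)%N ->
  P * \sum_(s in top) F k s - n%:R ^+ 2 * lam * (P * #|top|%:R) <=
  \sum_(s in top) F k.+1 s.
Proof.
move=> k_gt0; pose g v := f k v - P; pose G := value g k.
have GE s : s \in top -> value (f k) k s = P + G s.
  by move=> sT; have [v sv] := side_vertex k sT; rewrite /G !(value1 _ sv) addrC subrK.
have PN : P * #|top|%:R = \sum_(s in top) P.
  by rewrite sumr_const mulr_natr.
have G0 : \sum_(s in top) G s = 0.
  have := f_mean k; rewrite (eq_bigr _ GE) big_split/= -PN => /eqP.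
  by rewrite -subr_eq0 addrAC subrr add0r => /eqP.
(* The variance is at most the second moment of [f k], and [f k] lies in [0, 1] with mean [P]. *)
have G2 : \sum_(s in top) G s ^+ 2 <= P * #|top|%:R.
  rewrite -(f_mean k); apply: le_trans (_ : \sum_(s in top) (G s ^+ 2
      + 2 * P * G s + P ^+ 2) <= _).
    rewrite !big_split/= -[X in _ + X + _]mulr_sumr G0 mulr0 addr0 lerDl.
    by apply: sumr_ge0 => s _; exact: sqr_ge0.
  apply: ler_sum => s sT; have /andP[] := value_in01 k sT; rewrite GE//; nra.
have n_gt0 : (0 < n)%N by rewrite (leq_trans k_gt0)// -ltnS.
pose e : R := n%:R ^+ 2 * lam.
have e_gt0 : 0 < e by rewrite mulr_gt0// exprn_gt0// ltr0n.
pose C s := star_mean G (initial k s).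
(* Uses [k * n ^ 2 <= n ^ 4], which follows from [k <= n] and [0 < n]. *)
have C2 : \sum_(s in top) C s ^+ 2 <= e ^+ 2 * (P * #|top|%:R).
  have k_le : (k <= k)%N by [].
  apply: le_trans (star_mean_bound k_le G0) _.
  apply: le_trans (ler_wpM2l _ G2) _.
    by rewrite mulr_ge0// sqr_ge0.
  apply: ler_wpM2r; first by rewrite mulr_ge0.
  rewrite /e exprMn exprMn -exprM mulrA ler_wpM2r ?sqr_ge0//.
  rewrite -natrX -natrX -natrM ler_nat.
  rewrite expnM -[((_ ^ 2) ^ 2)%N]mulnn leq_mul//.
  have kn : (k <= n)%N by rewrite -ltnS.
  by rewrite (leq_trans kn)// -mulnn leq_pmulr.
(* [F k] lies in [0, 1] and is at most its factor of color 0, present since [0 < k]. *)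
have F2 : \sum_(s in top) F k s ^+ 2 <= P * #|top|%:R.
  rewrite -(f_mean ord0); apply: ler_sum => s sT.
  have := F_le k_gt0 sT; have /andP[F0 F1] := F_in01 k sT; nra.
have cov : - (e * (P * #|top|%:R)) <= \sum_(s in top) F k s * G s.
  under eq_bigr do rewrite -F_initial.
  rewrite (sum_star_mean (F k) G (ltnW (ltn_ord k))).
  under eq_bigr do rewrite F_initial.
  have -> : - (e * (P * #|top|%:R)) =
     - (2^-1 * e * (P * #|top|%:R) + 2^-1 * e^-1 * (e ^+ 2 * (P * #|top|%:R))).
    by field; rewrite gt_eqF.
  apply: le_trans (_ : - (2^-1 * e * \sum_(s in top) F k s ^+ 2
     + 2^-1 * e^-1 * \sum_(s in top) C s ^+ 2) <= _).
    rewrite lerN2; apply: lerD; apply: ler_wpM2l => //.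
      by rewrite mulr_ge0// ltW.
    by rewrite mulr_ge0// invr_ge0 ltW.
  rewrite !mulr_sumr -big_split -sumrN; apply: ler_sum => s _ /=; rewrite -/(C s).
  rewrite -subr_ge0 opprK.
  have -> : F k s * C s + (2^-1 * e * F k s ^+ 2 + 2^-1 * e^-1 * C s ^+ 2) =
     2^-1 * e^-1 * (e * F k s + C s) ^+ 2 by field; rewrite gt_eqF.
  apply: mulr_ge0; last exact: sqr_ge0.
  by rewrite mulr_ge0// invr_ge0 ltW.
under [leRHS]eq_bigr => s sT do rewrite FS GE// mulrDr.
rewrite big_split/= -mulr_suml [P * _]mulrC lerD2l.
exact: cov.
Qed.

(** The first factor has mean exactly [P], and each of the other [n] costs at most [n^2 lam P].
    Earlier errors are only multiplied by [P <= 1]. *)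
Lemma product_mixing : P ^+ n.+1 * #|top|%:R - n%:R ^+ 3 * lam * (P * #|top|%:R) <=
  \sum_(s in top) \prod_i value (f i) i s.
Proof.
have N_ge0 : 0 <= #|top|%:R :> R by [].
have step (j : nat) : (j < n.+1)%N ->
    P ^+ j.+1 * #|top|%:R - j%:R * (n%:R ^+ 2 * lam * (P * #|top|%:R)) <=
    \sum_(s in top) F j.+1 s.
  elim: j => [_|j IH jn].
    rewrite mul0r subr0 expr1 -(f_mean ord0) le_eqVlt; apply/orP; left; apply/eqP.
    by apply: eq_bigr => s _; rewrite (FS ord0) /F big_pred0 ?mul1r.
  have := F_step (k := Ordinal jn) isT; apply: le_trans.
  rewrite -natr1 mulrDl mul1r opprD addrA lerD2r.
  apply: le_trans (ler_wpM2l P_ge0 (IH (ltnW jn))).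
  rewrite mulrBr [P ^+ j.+2]exprS -mulrA lerD2l lerN2.
  by rewrite ler_piMl// !mulr_ge0// ?(ltW lam_gt0)// exprn_ge0.
have := step n (ltnSn n).
rewrite (eq_bigr (fun s => \prod_i value (f i) i s)) => [|s _].
  by rewrite [n%:R * _]mulrA [n%:R * _]mulrA -exprS.
by apply: eq_bigl => i; rewrite ltn_ord.
Qed.

End Mixing.
End Partite.

(** * Convex hulls and convex combinations *)

Section ConvexHull.
Variables (R : realType) (E : lmodType R).
Implicit Types A : set E.

Lemma conv_lmodE (t : {i01 R}) (x y : convex_lmodType E) :
  conv t x y = t%:num *: (x : E) + (1 - t%:num) *: (y : E).
Proof. by []. Qed.

(** Normalising by the total weight allows induction: the head is joined to the average of the tail,
    unless the tail has weight 0. *)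
Lemma convex_sum A (I : eqType) (r : seq I) (w : I -> R) (x : I -> E) :
  convex_set A -> (forall i, 0 <= w i) -> (forall i, i \in r -> A (x i)) ->
  \sum_(i <- r) w i != 0 -> A ((\sum_(i <- r) w i)^-1 *: \sum_(i <- r) w i *: x i).
Proof.
move=> A_convex w_ge0; elim: r => [|j r IH] xA; first by rewrite big_nil eqxx.
rewrite !big_cons => w_neq0.
have xjA : A (x j) by apply: xA; rewrite mem_head.
have sum_ge0 : 0 <= \sum_(i <- r) w i by exact: sumr_ge0.
have [r0|r_neq0] := eqVneq (\sum_(i <- r) w i) 0.
  have -> : \sum_(i <- r) w i *: x i = 0.
    rewrite big_seq big1// => i ir.
    move/eqP: r0; rewrite psumr_eq0// => /allP/(_ i ir)/eqP->.
    by rewrite scale0r.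
  by move: w_neq0; rewrite r0 !addr0 => wj; rewrite scalerA mulVf// scale1r.
have yA : A ((\sum_(i <- r) w i)^-1 *: \sum_(i <- r) w i *: x i).
  by apply: IH => // i ir; apply: xA; rewrite inE ir orbT.
set W := \sum_(i <- r) w i in sum_ge0 r_neq0 w_neq0 yA *.
have W_gt0 : 0 < w j + W by rewrite lt_neqAle eq_sym w_neq0 addr_ge0.
have t0 : 0 <= w j / (w j + W) by rewrite divr_ge0// ltW.
have t1 : w j / (w j + W) <= 1 by rewrite ler_pdivrMr// mul1r lerDl.
have := A_convex _ _ (Itv01 t0 t1) (mem_set xjA) (mem_set yA); rewrite inE.
congr A; rewrite conv_lmodE/= scalerDr !scalerA mulrC; congr (_ + _ *: _).
by field; rewrite r_neq0 w_neq0.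
Qed.

Lemma convex_hull_sum A (I : finType) (w : I -> R) (x : I -> E) :
  (forall i, 0 <= w i) -> \sum_i w i = 1 -> (forall i, A (x i)) ->
  convex_hull A (\sum_i w i *: x i).
Proof.
move=> w_ge0 w1 xA M [M_convex AM].
have := @convex_sum M _ (index_enum I) w x M_convex w_ge0.
rewrite w1 invr1 scale1r oner_neq0; apply=> // i _.
exact/AM/xA.
Qed.

(** The convex combinations of the family form a convex set containing its points, and the hull is
    the smallest such set. *)
Lemma convex_hull_range (I : finType) (x : I -> E) z :
  convex_hull (range x) z ->
  exists w : I -> R, [/\ forall i, 0 <= w i, \sum_i w i = 1
    & z = \sum_i w i *: x i].
Proof.
pose M := [set z | exists w : I -> R, [/\ forall i, 0 <= w i,
  \sum_i w i = 1 & z = \sum_i w i *: x i]]%classic.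
move=> z_hull; apply: (z_hull M); split=> [y1 y2 t|_ [i _ <-]]; last first.
  exists (fun j => (j == i)%:R); split => [//||].
    by rewrite (bigD1 i)//= eqxx big1 ?addr0// => j /negPf->.
  rewrite (bigD1 i)//= eqxx scale1r big1 ?addr0// => j /negPf->.
  by rewrite mulr0n scale0r.
rewrite !inE => -[w1 [w1_ge0 w11 ->]] [w2 [w2_ge0 w21 ->]].
pose s : R := t%:num.
have s0 : 0 <= s by rewrite /s ge0.
have s1 : 0 <= 1 - s by rewrite subr_ge0 /s le1.
exists (fun i => s * w1 i + (1 - s) * w2 i); split.
- by move=> i; rewrite addr_ge0// mulr_ge0.
- by rewrite big_split/= -!mulr_sumr w11 w21 !mulr1 addrC subrK.
- rewrite conv_lmodE !scaler_sumr -big_split; apply: eq_bigr => i _ /=.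
  by rewrite !scalerA -scalerDl.
Qed.

End ConvexHull.

(** * Limits along an ultrafilter *)

Section UltraLimit.
Variables (T : Type) (G : set_system T).
Hypothesis G_ultra : UltraFilter G.

Lemma ultra_fmap (U : Type) (h : T -> U) : UltraFilter (h @ G)%classic.
Proof.
split=> [|H H_proper GH]; first exact: fmap_proper_filter.
apply/seteqP; split=> // A HA.
have [//|GnA] := in_ultra_setVsetC (h @^-1` A)%classic G_ultra.
have /GH HnA : (h @ G)%classic (~` A)%classic by [].
exfalso; apply: (@filter_not_empty _ H H_proper).
by rewrite -(setICr A); exact: filterI.
Qed.

Lemma ultra_cvg01 (R : realType) (h : T -> R) :
  (forall x, 0 <= h x <= 1) -> exists2 l : R, 0 <= l <= 1 & (h @ G --> l)%classic.
Proof.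
move=> h01.
have F01 : \forall x \near G, `[0, 1]%classic (h x).
  by apply: filterE => x; rewrite /= in_itv; exact: h01.
have := @segment_compact R 0 1; rewrite compact_ultra.
move=> /(_ _ (ultra_fmap h) F01)[l [l01 hl]]; exists l => //.
Qed.

(** Otherwise the complements of the finitely many fibres, and so their empty intersection, would
    belong to [G]. *)
Lemma ultra_finite (I : finType) (h : T -> I) :
  exists i, \forall x \near G, h x = i.
Proof.
apply: contrapT => no_i.
have : \forall x \near G, forall i, h x <> i.
  apply: filter_forall => i.
  have [Gi|//] := in_ultra_setVsetC (h @^-1` [set i])%classic G_ultra.
  by exfalso; apply: no_i; exists i.
by move=> /filter_ex[x /(_ (h x))].
Qed.

End UltraLimit.

(** * Pach's theorem for arbitrary maps on the vertices *)

Section PachMap.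
Variables (R : realType) (n : nat) (V : finType) (P : R).
Hypotheses (n_gt0 : (0 < n)%N) (P_pach : pach_constant n P).

(** Injectivity preserves cardinalities, so densities in the image pull back to the sides. *)
Lemma pach_injective (f : V -> 'rV[R]_n) (S : 'I_n.+1 -> {set V}) :
  injective f ->
  exists U : 'I_n.+1 -> {set V},
    (forall i, U i \subset S i /\ P * #|S i|%:R <= #|U i|%:R) /\
    exists z, forall x : 'I_n.+1 -> V, (forall i, x i \in U i) ->
      convex_hull (range (f \o x)) z.
Proof.
move=> f_inj; have [_ /(_ (fun i => [fset f v | v in enum (S i)]%fset))] := P_pach.
move=> [U [US U_large [z z_hull]]].
have card_image (A : {set V}) : #|` [fset f v | v in enum A]%fset| = #|A|.
  rewrite card_imfset//= cardE.
  by rewrite undup_id// enum_uniq.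
exists (fun i => [set v in S i | f v \in U i]%SET); split.
  move=> i; split; first by apply/fintype.subsetP => v; rewrite inE => /andP[].
  rewrite -card_image; apply: le_trans (U_large i) _.
  rewrite ler_nat -(card_image [set v in S i | f v \in U i]%SET).
  apply: fsubset_leq_card; apply/fsubsetP => y yU.
  have /imfsetP[v /= vS yE] := fsubsetP (US i) y yU.
  apply/imfsetP; exists v => //=.
  by rewrite mem_enum inE -yE yU andbT -mem_enum.
exists z => x xU; apply: z_hull => i /=.
by have := xU i; rewrite inE => /andP[].
Qed.

(* Pach's theorem concerns sets of points, so that a map which is not injective
   has to be perturbed first. *)
Definition perturb (f : V -> 'rV[R]_n) (m : nat) (v : V) : 'rV[R]_n :=
  f v + (m.+1%:R^-1 * (enum_rank v)%:R) *: const_mx 1.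

(** For distinct [u] and [v], equality of the first coordinates determines [m], so each of the
    finitely many pairs is separated for large [m]. *)
Lemma perturb_injective f : \forall m \near \oo%classic, injective (perturb f m).
Proof.
have pair u v : \forall m \near \oo%classic, perturb f m u = perturb f m v -> u = v.
  have [->|uv] := eqVneq u v; first exact: filterE.
  pose d := f u (@ord0 0) (Ordinal n_gt0) - f v ord0 (Ordinal n_gt0).
  pose e : R := (enum_rank v)%:R - (enum_rank u)%:R.
  have e_neq0 : e != 0.
    rewrite subr_eq0 eqr_nat; apply: contra uv => /eqP/val_inj/enum_rank_inj->.
    exact: eqxx.
  near=> m => /matrixP/(_ ord0 (Ordinal n_gt0)); rewrite !mxE !mulr1 => uv_eq.
  have md : m.+1%:R * d = e.
    have : d = m.+1%:R^-1 * e.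
      move: uv_eq; rewrite /d /e; move: (_^-1) (f u _ _) (f v _ _) => x a b ab.
      by rewrite mulrBr; apply/eqP; rewrite subr_eq addrAC eq_sym subr_eq ab addrC.
    by move=> ->; rewrite mulrA divff ?mul1r.
  have d_neq0 : d != 0 by apply: contraNneq e_neq0 => d0; rewrite -md d0 mulr0.
  have mE : m.+1%:R = e / d by rewrite -md mulfK.
  have : e / d < m%:R by near: m; exact: nbhs_infty_gtr.
  by rewrite -mE ltr_nat ltnNge leqW.
have : \forall m \near \oo%classic, forall u v, perturb f m u = perturb f m v -> u = v.
  by apply: filter_forall => u; apply: filter_forall => v; exact: pair.
by apply: filterS => m h u v; exact: h.
Unshelve. all: by end_near.
Qed.

(* The subsets and the barycentric coordinates of the perturbed configurations
   converge along an ultrafilter. *)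
Lemma pach_map (f : V -> 'rV[R]_n) (S : 'I_n.+1 -> {set V}) :
  exists U : 'I_n.+1 -> {set V},
    (forall i, U i \subset S i /\ P * #|S i|%:R <= #|U i|%:R) /\
    exists z, forall x : 'I_n.+1 -> V, (forall i, x i \in U i) ->
      convex_hull (range (f \o x)) z.
Proof.
have [G [G_ultra oo_G]] := @ultraFilterLemma nat \oo%classic _.
(* A datum holds the subsets, the common point, and its barycentric coordinates for each choice of
   vertices. *)
pose data := ({ffun 'I_n.+1 -> {set V}} * 'rV[R]_n *
  ({ffun 'I_n.+1 -> V} -> 'I_n.+1 -> R))%type.
pose good m (D : data) :=
  (forall i, D.1.1 i \subset S i /\ P * #|S i|%:R <= #|D.1.1 i|%:R) /\
  forall x : {ffun 'I_n.+1 -> V}, (forall i, x i \in D.1.1 i) ->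
    \sum_i D.2 x i = 1 /\ D.1.2 = \sum_i D.2 x i *: perturb f m (x i).
have /choice[D D_good] : forall m, exists D : data,
    (forall x i, 0 <= D.2 x i <= 1) /\ (injective (perturb f m) -> good m D).
  move=> m.
  have [/pach_injective|not_inj] := pselect (injective (perturb f m)); last first.
    (* A dummy value for the finitely many [m] where the perturbation is not injective; the weights
       stay in [0, 1], so their limits exist. *)
    exists (finfun (fun=> finset.set0), 0, fun _ _ => 0); split=> // ? ?.
    by rewrite lexx ler01.
  move=> /(_ S)[U [US [z z_hull]]].
  have wP x : exists w : 'I_n.+1 -> R, (forall i, 0 <= w i <= 1) /\
      ((forall i, x i \in U i) ->
       \sum_i w i = 1 /\ z = \sum_i w i *: perturb f m (x i)).
    have [xU|nxU] := pselect (forall i, x i \in U i); last first.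
      by exists (fun=> 0); split=> // i; rewrite lexx ler01.
    have [w [w_ge0 w1 zE]] := convex_hull_range (z_hull x xU).
    exists w; split=> // i; rewrite w_ge0 -w1 (bigD1 i)//= lerDl.
    exact: sumr_ge0.
  have [w w_prop] := choice wP.
  exists (finfun U, z, fun x : {ffun 'I_n.+1 -> V} => w x); split=> [x i|_ /=].
    exact: (w_prop x).1.
  split=> [i|x xU] /=; first by rewrite ffunE.
  by apply: (w_prop x).2 => i; have := xU i; rewrite ffunE.
have G_good : \forall m \near G, good m (D m).
  have : \forall m \near G, injective (perturb f m).
    exact/oo_G/perturb_injective.
  by apply: filterS => m; have [] := D_good m.
have [U G_U] := ultra_finite G_ultra (fun m => (D m).1.1).
have w_lim x i : exists2 l : R, 0 <= l <= 1 &
    ((fun m => (D m).2 x i) @ G --> l)%classic.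
  by apply: ultra_cvg01 => m; have [] := D_good m.
have /choice[w w_prop] : forall xi : {ffun 'I_n.+1 -> V} * 'I_n.+1,
    exists l : R, 0 <= l <= 1 /\ ((fun m => (D m).2 xi.1 xi.2) @ G --> l)%classic.
  by case=> x i; have [l] := w_lim x i; exists l.
have cadd : continuous (fun y : R * R => y.1 + y.2) by exact: add_continuous.
have csum (I : finType) (F : I -> nat -> R) (l : I -> R) :
    (forall i, F i @ G --> l i)%classic ->
    ((fun m => \sum_i F i m) @ G --> \sum_i l i)%classic.
  move=> cF.
  exact: (@cvg_big _ _ _ _ xpredT cadd _ G _ _ _ _ (fun i _ => cF i)).
have near_cvg (h k : nat -> R) (l : R) : (\forall m \near G, h m = k m) ->
    (h @ G --> l)%classic -> (k @ G --> l)%classic.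
  by move=> /near_eq_cvg hk; exact: cvg_trans.
have sum_w (x : {ffun 'I_n.+1 -> V}) : (forall i, x i \in U i) -> \sum_i w (x, i) = 1.
  move=> xU.
  have cw : ((fun m => \sum_i (D m).2 x i) @ G --> \sum_i w (x, i))%classic.
    by apply: csum => i; have [] := w_prop (x, i).
  apply: (cvg_unique _ cw); first exact: Rhausdorff.
  apply: cvg_near_cst; near=> m.
  have [_ /(_ x)[]//] : good m (D m) by near: m.
  by move=> i; have -> : (D m).1.1 = U by near: m.
(* The common points converge to the limit combination of every admissible [x]; by uniqueness of
   limits all these combinations coincide. *)
have lim_z (x : {ffun 'I_n.+1 -> V}) : (forall i, x i \in U i) -> forall c : 'I_n,
    ((fun m => (D m).1.2 ord0 c) @ G -->
      (\sum_i w (x, i) *: f (x i)) ord0 c)%classic.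
  move=> xU c.
  have : ((fun m => \sum_i (D m).2 x i * perturb f m (x i) ord0 c) @ G -->
      \sum_i w (x, i) * f (x i) ord0 c)%classic.
    apply: csum => i; apply: cvgM; first by have [] := w_prop (x, i).
    have : ((fun m => f (x i) ord0 c + @harmonic R m * (enum_rank (x i))%:R) @ G -->
        f (x i) ord0 c + 0 * (enum_rank (x i))%:R)%classic.
      apply: cvgD; first exact: cvg_cst.
      apply: cvgM; last exact: cvg_cst.
      exact: cvg_trans (cvg_app _ oo_G) cvg_harmonic.
    rewrite mul0r addr0; apply: near_cvg; near=> m.
    by rewrite !mxE mulr1.
  have -> : (\sum_i w (x, i) *: f (x i)) ord0 c =
      \sum_i w (x, i) * f (x i) ord0 c.
    by rewrite summxE; apply: eq_bigr => i _; rewrite mxE.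
  apply: near_cvg; near=> m.
  have [_ /(_ x)[i|_ ->]] : good m (D m) by near: m.
    by have -> : (D m).1.1 = U by near: m.
  by rewrite summxE; apply: eq_bigr => i _; rewrite [RHS]mxE.
exists U; split.
  near G => m.
  have <- : (D m).1.1 = U by near: m.
  by have [] : good m (D m) by near: m.
have [[x0 x0U]|no_x] := pselect (exists x : {ffun 'I_n.+1 -> V},
    forall i, x i \in U i); last first.
  (* Some [U i] is empty, so any point will do. *)
  exists 0 => x xU; exfalso; apply: no_x; exists (finfun x) => i.
  by rewrite ffunE.
exists (\sum_i w (x0, i) *: f (x0 i)) => x xU.
pose x' : {ffun 'I_n.+1 -> V} := finfun x.
have x'U i : x' i \in U i by rewrite ffunE.
have -> : \sum_i w (x0, i) *: f (x0 i) = \sum_i w (x', i) *: (f \o x) i.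
  apply/rowP => c; transitivity ((\sum_i w (x', i) *: f (x' i)) ord0 c).
    exact: (cvg_unique (@Rhausdorff R) (lim_z x0 x0U c) (lim_z x' x'U c)).
  by congr (fun_of_matrix _ ord0 c); apply: eq_bigr => i _; rewrite /= ffunE.
apply: convex_hull_sum => [i|//|i]; last by exists i.
  by have [/andP[]] := w_prop (x', i).
exact: sum_w.
Unshelve. all: by end_near.
Qed.

End PachMap.

(** All terms are nonnegative, and the term [k = 0] equals [n (n+1)^n (2^n - 1)], where
    [(n+1)^n >= n^2] and the last factor is at least 1. *)
Lemma cube_le_mixing_constant (R : realType) (n : nat) : (0 < n)%N ->
  n%:R ^+ 3 <= mixing_constant R n.
Proof.
case: n => // n _; rewrite /mixing_constant.
have term_ge0 (a b : R) (k m : nat) : 0 <= a -> 0 <= b ->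
    0 <= a * b * (k.+1%:R * k.+2%:R ^+ m - k.+1%:R ^+ m.+1) :> R.
  move=> a0 b0; rewrite !mulr_ge0// subr_ge0 exprS ler_wpM2l//.
  by rewrite lerXn2r// ?nnegrE// ler_nat.
rewrite (bigD1 ord0)//= !subn0; apply: ler_wpDr.
  by apply: sumr_ge0 => k _; apply: term_ge0 => //; rewrite divr_ge0// exprn_ge0.
rewrite mul1r expr1n; have n_neq0 : (n`!%:R : R) != 0 by rewrite pnatr_eq0 -lt0n fact_gt0.
have -> : n.+1`!%:R * (n.+2%:R ^+ n.+1 / n`!%:R) = n.+1%:R * n.+2%:R ^+ n.+1 :> R.
  by rewrite factS natrM; field.
apply: le_trans (_ : n.+1%:R * n.+2%:R ^+ n.+1 * 1 <= _).
  rewrite mulr1 exprS ler_wpM2l// -!natrX ler_nat.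
  case: n {n_neq0} => // n; apply: (@leq_trans (n.+2 ^ n.+2)%N).
    by rewrite leq_pexp2l.
  by rewrite leq_exp2r.
rewrite ler_wpM2l ?mulr_ge0// ?exprn_ge0// lerBrDr.
have -> : 1 + 1 = 2 ^+ 1 :> R by rewrite expr1.
by rewrite ler_weXn2l// ler1n.
Qed.

Theorem theorem8p5 (R : realType) (n : nat) (n_ge1 : (1 <= n)%N)
    (V : finType) (X : {set {set V}})
    (X_complex : simplicial_complex X) (X_pure : pure n X)
    (X_connected : connected_links n X)
    (S : 'I_n.+1 -> {set V})
    (X_partite : partite n X S) (X_regular : partite_regular n X S)
    (lam : R) (lam_gt0 : 0 < lam) (lam_lt1 : lam < 1)
    (X_spec : forall (k : nat) (tau : {set V}), (k < n)%N ->
       tau \in faces X k ->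
       (walk_spectrum R n X tau `<=` `[-1, lam] `|` [set 1])%classic)
    (P : R) (P_pach : pach_constant n P) :
  P * (P ^+ n - mixing_constant R n * lam) <= overlap R n X.
Proof.
have [f -> _] := overlap_attained R n X.
have [y -> y_max] := max_covering_attained X f.
have [U [US [z z_hull]]] := pach_map n_ge1 P_pach f S.
apply: le_trans (y_max z); rewrite {y y_max}/covering_ratio.
have P_gt0 : 0 < P by case: P_pach.
set T := faces X n.+1.
have [s0 s0T _] := X_pure _ X_complex.1.
have N_gt0 : 0 < #|T|%:R :> R by rewrite ltr0n; apply/card_gt0P; exists s0.
have S_gt0 i : 0 < #|S i|%:R :> R.
  have [v vS] := side_vertex X_partite i s0T.
  rewrite ltr0n; apply/card_gt0P; exists v.
  by have := finset.set11 v; rewrite -vS finset.inE => /andP[].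
have U_gt0 i : 0 < #|U i|%:R :> R.
  by apply: lt_le_trans (US i).2; rewrite mulr_gt0.
have P_le1 : P <= 1.
  rewrite -(ler_pM2r (S_gt0 ord0)) mul1r; apply: le_trans (US ord0).2 _.
  by rewrite ler_nat subset_leq_card// (US ord0).1.
(* The scaling that gives the indicator of [U i] mean exactly [P] on [S i]; it is at most 1 by the
   density of [U i]. *)
pose r i : R := P * #|S i|%:R / #|U i|%:R.
have r_ge0 i : 0 <= r i by rewrite divr_ge0// mulr_ge0// ltW.
have r_le1 i : r i <= 1 by rewrite ler_pdivrMr// mul1r (US i).2.
pose g i v : R := r i * (v \in U i)%:R.
have g_mean i : \sum_(s in T) value S (g i) i s = P * #|T|%:R.
  have [K K_deg] := X_regular i.
  (* Partite regularity: every vertex of color [i] is counted [K] times. *)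
  have sumE (h : V -> R) : \sum_(s in T) value S h i s = (\sum_(v in S i) h v) * K%:R.
    have := sum_value X S finset.set0 h i (fun=> 1).
    rewrite (eq_bigl (mem T)) => [|s]; last by rewrite finset.sub0set andbT.
    under eq_bigr do rewrite mulr1.
    move=> ->; rewrite mulr_suml; apply: eq_bigr => v vS; congr (_ * _).
    by rewrite -top_degreeE finset.setU0 K_deg.
  have N_eq : #|T|%:R = #|S i|%:R * K%:R :> R.
    transitivity (\sum_(s in T) value S (fun=> 1 : R) i s).
      rewrite -sumr_const; apply: eq_bigr => s sT.
      by have [v sv] := side_vertex X_partite i sT; rewrite (value1 _ sv).
    by rewrite sumE sumr_const.
  rewrite sumE N_eq mulrA; congr (_ * _).
  rewrite /g -mulr_sumr.
  have -> : \sum_(v in S i) (v \in U i)%:R = #|U i|%:R :> R.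
    rewrite -sumr_const big_mkcond [RHS]big_mkcond; apply: eq_bigr => v _.
    by case: (boolP (v \in U i)) => [/(fintype.subsetP (US i).1)->|_]//; case: ifP.
  by rewrite /r divfK// gt_eqF.
have := product_mixing X_complex X_pure X_connected X_partite lam_gt0 X_spec
  (ltW P_gt0) P_le1 (f := g) _ _ g_mean.
have g_ge0 i v : 0 <= g i v by rewrite mulr_ge0.
have g_le1 i v : g i v <= 1.
  by rewrite /g; case: (v \in U i); rewrite ?mulr1 ?mulr0.
move=> /(_ g_ge0 g_le1) mixing.
rewrite ler_pdivlMr//; apply: le_trans (le_trans mixing _).
  rewrite exprS -[P * P ^+ n * _]mulrA mulrBr mulrBl -[leLHS]/(_ - _).
  rewrite lerB//; first by rewrite mulrA.
  have -> : n%:R ^+ 3 * lam * (P * #|T|%:R) = P * (n%:R ^+ 3 * lam) * #|T|%:R by ring.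
  rewrite ler_pM2r// ler_pM2l// ler_pM2r//.
  exact: cube_le_mixing_constant.
have -> : #|covering X f z|%:R = \sum_(s in T) (s \in covering X f z)%:R :> R.
  rewrite -sumr_const big_mkcond [RHS]big_mkcond; apply: eq_bigr => s _.
  case: (boolP (s \in covering X f z)) => [|_]; last by case: ifP.
  by rewrite finset.inE => /andP[->].
(* The product is at most 1, and it is nonzero only if every vertex [x i] of [s] lies in [U i], in
   which case [s] covers [z]. *)
apply: ler_sum => s sT.
have [covered|] := boolP (s \in covering X f z).
  apply: prodr_ile1 => i _; have [v sv] := side_vertex X_partite i sT.
  by rewrite (value1 _ sv) g_ge0 g_le1.
apply: contraNle => prod_gt0; rewrite finset.inE sT/=; apply/asboolP.
have /choice[x x_prop] : forall i, exists v, s :&: S i = finset.set1 v.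
  by move=> i; exact: (side_vertex X_partite i sT).
have x_in i : x i \in s.
  by have := finset.set11 (x i); rewrite -x_prop finset.inE => /andP[].
have xU i : x i \in U i.
  apply/negPn/negP => nxU; move: prod_gt0; rewrite ltNge => /negP; apply.
  by rewrite (bigD1 i)//= (value1 _ (x_prop i)) /g (negPf nxU) mulr0 mul0r.
move=> M [M_convex M_s]; apply: (z_hull x xU M); split=> // _ [i _ <-].
by apply: M_s; exists (x i) => //; exact: x_in.
Qed.
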